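(* Let $V_3=\langle a_{13},a_{23},b_{13},b_{23}\rangle$ and $\widetilde V_3=\langle V_3,b_{12}\rangle$ be the subgroups of the singular pure braid group $SP_3$ generated by the indicated elements. Then: 1) $SP_3$ is the (internal) semidirect product of the normal subgroup $\widetilde V_3$ and the subgroup $\langle a_{12}\rangle$, where $\langle a_{12}\rangle\cong\mathbb{Z}$. 2) $\widetilde V_3$ has the presentation $$\widetilde V_3=\langle a_{13},a_{23},b_{13},b_{23},b_{12}\mid [a_{13},b_{13}]=[a_{23},b_{23}]=[a_{13}a_{23},b_{12}]=1\rangle,$$ and it is an HNN-extension with base group $V_3$, stable letter $b_{12}$, associated subgroups $A\cong B=\langle a_{13}a_{23}\rangle$ and the identity isomorphism $A\to B$: $$\widetilde V_3=\langle V_3,b_{12}\mid \mathrm{rel}(V_3),\ b_{12}^{-1}(a_{13}a_{23})b_{12}=a_{13}a_{23}\rangle,$$ where $\mathrm{rel}(V_3)$ is the set of relations of $V_3$. 3) $V_3=\langle a_{13},a_{23},b_{13},b_{23}\mid [a_{13},b_{13}]=[a_{23},b_{23}]=1\rangle\cong\mathbb{Z}^2*\mathbb{Z}^2$.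
   Context: The singular braid group $SG_3$ is the group with generators $\sigma_1,\sigma_2,\tau_1,\tau_2$ and defining relations $$\sigma_1\sigma_2\sigma_1=\sigma_2\sigma_1\sigma_2,\quad \sigma_1\tau_1=\tau_1\sigma_1,\quad \sigma_2\tau_2=\tau_2\sigma_2,\quad \sigma_1\sigma_2\tau_1=\tau_2\sigma_1\sigma_2,\quad \sigma_2\sigma_1\tau_2=\tau_1\sigma_2\sigma_1.$$ The singular pure braid group $SP_3$ is the kernel of the homomorphism $\pi:SG_3\to S_3$ onto the symmetric group with $\pi(\sigma_i)=\pi(\tau_i)=(i,i+1)$ for $i=1,2$. The following elements of $SP_3$ are used: $$a_{12}=\sigma_1^2,\quad a_{13}=\sigma_2\sigma_1^2\sigma_2^{-1},\quad a_{23}=\sigma_2^2,\quad b_{12}=\sigma_1\tau_1,\quad b_{13}=\sigma_2\sigma_1\tau_1\sigma_2^{-1},\quad b_{23}=\sigma_2\tau_2.$$ Notation: $[a,b]=a^{-1}b^{-1}ab$; $*$ denotes the free product. Writing a group as $\langle X\mid R\rangle$ for given elements $X$ of it means that these elements generate it and that $R$ is a set of defining relations. *)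

(* Defs.v *)
From HB Require Import structures.
From mathcomp Require Import all_boot perm ssralg ssrint.
From mathcomp Require Import boolp classical_sets.

Set Implicit Arguments.
Unset Strict Implicit.
Unset Printing Implicit Defensive.

Local Open Scope group_scope.
Local Open Scope classical_set_scope.
Local Open Scope quotient_scope.

Definition is_subgroup (G : groupType) (A : set G) :=
  A 1 /\ forall x y, A x -> A y -> A (x / y).

Record subgroup (G : groupType) := Subgroup {
  sg_set : set G;
  sg_setP : is_subgroup sg_set }.

Section SubgroupGroup.
Variables (G : groupType) (H : subgroup G).

Definition sg_sort : Type := {x : G | x \in sg_set H}.

HB.instance Definition _ := SubChoice.copy sg_sort {x : G | x \in sg_set H}.

Fact sg_group_closed : group_closed (fun x : G => x \in sg_set H).
Proof.
have [H1 HM] := sg_setP H; split; first exact/mem_set.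
by move=> x y /set_mem Hx /set_mem Hy; apply/mem_set/HM.
Qed.

HB.instance Definition _ :=
  SubChoice_isSubGroup.Build G (fun x : G => x \in sg_set H) sg_sort
    sg_group_closed.

Definition sg_group : groupType := sg_sort.

End SubgroupGroup.

(* Declared in this order so that a subgroup used as a type is the group
   sg_group H rather than set_type (sg_set H). *)
Coercion sg_group : subgroup >-> groupType.
Coercion sg_set : subgroup >-> set.

Section Subgroups.
Variable G : groupType.
Implicit Types A : set G.

Definition bigcap_sg (P : set (subgroup G)) : set G :=
  [set x | forall H : subgroup G, P H -> sg_set H x].

Fact bigcap_sgP P : is_subgroup (bigcap_sg P).
Proof.
split=> [H _|x y xP yP H PH]; first by have [] := sg_setP H.
by have [_ HM] := sg_setP H; apply: HM; [apply: xP | apply: yP].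
Qed.

Definition gensg A : subgroup G :=
  Subgroup (bigcap_sgP [set H | A `<=` H]).

Definition normalised (H : set G) A := forall x g, H x -> A g -> H (x ^ g).

Definition normal_closure A : subgroup G :=
  Subgroup (bigcap_sgP [set H | A `<=` H /\ normalised H setT]).

End Subgroups.

Section Morphisms.
Variables G H : groupType.

Definition isog := exists f : {multiplicative G -> H}, bijective f.

Fact ker_subgroup (f : {multiplicative G -> H}) :
  is_subgroup [set x | f x = 1].
Proof.
have f1 : f 1 = 1.
  by apply: (@mulgI _ (f 1)); rewrite -gmulfM !mulg1.
split=> //= x y fx fy; apply: (@mulIg _ (f y)).
by rewrite -gmulfM mulgVK fx fy mulg1.
Qed.

Definition kersg (f : {multiplicative G -> H}) : subgroup G :=
  Subgroup (ker_subgroup f).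

End Morphisms.

Definition internal_semidirect (T : groupType) (G N H : subgroup T) :=
  [/\ N `<=` G, H `<=` G, normalised N G,
      N `&` H = [set 1] & G = [set x * y | x in N & y in H] :> set T].

(* A word is a list of letters (x, b), standing for x if b = false and for the
   inverse of x if b = true. *)
Section FreeGroup.
Variable X : choiceType.

Definition word := seq (X * bool).
HB.instance Definition _ := Choice.on word.

Inductive free_eq : word -> word -> Prop :=
| Free_refl u : free_eq u u
| Free_sym u v : free_eq u v -> free_eq v u
| Free_trans v u w : free_eq u v -> free_eq v w -> free_eq u w
| Free_cancel u v x b : free_eq (u ++ (x, b) :: (x, ~~ b) :: v) (u ++ v).

Definition free_eqb (u v : word) : bool := `[< free_eq u v >].

Fact free_eqb_refl : reflexive free_eqb.
Proof. by move=> u; apply/asboolP/Free_refl. Qed.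
Fact free_eqb_sym : symmetric free_eqb.
Proof. by move=> u v; apply/asboolP/asboolP; apply: Free_sym. Qed.
Fact free_eqb_trans : transitive free_eqb.
Proof.
by move=> v u w /asboolP uv /asboolP vw; apply/asboolP/(Free_trans uv vw).
Qed.

Canonical free_eqb_equiv :=
  EquivRel free_eqb free_eqb_refl free_eqb_sym free_eqb_trans.

Definition free_group : Type := {eq_quot free_eqb}.
HB.instance Definition _ := Choice.on free_group.
HB.instance Definition _ := EqQuotient.on free_group.

Definition winv (u : word) : word := rev [seq (p.1, ~~ p.2) | p <- u].

Lemma free_eqP (u v : word) : \pi_free_group u = \pi v <-> free_eq u v.
Proof.
rewrite (rwP (@eqmodP _ free_eqb_equiv u v)).
by split=> /asboolP.
Qed.

Lemma free_eq_cat u u' v v' :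
  free_eq u u' -> free_eq v v' -> free_eq (u ++ v) (u' ++ v').
Proof.
move=> uu' vv'; apply: (@Free_trans (u' ++ v)).
  elim: uu' => {u u'} [u|u w _|w u s _ IH1 _ IH2|u w x b].
  - exact: Free_refl.
  - exact: Free_sym.
  - exact: Free_trans IH1 IH2.
  - by rewrite -!catA !cat_cons; apply: Free_cancel.
elim: vv' => {v v'} [v|v w _|w v s _ IH1 _ IH2|v w x b].
- exact: Free_refl.
- exact: Free_sym.
- exact: Free_trans IH1 IH2.
- by rewrite !catA; apply: Free_cancel.
Qed.

Lemma winvK : involutive winv.
Proof.
move=> u; rewrite /winv map_rev revK -map_comp -[RHS]map_id.
by apply: eq_map => -[x b] /=; rewrite negbK.
Qed.

Lemma winv_cat u v : winv (u ++ v) = winv v ++ winv u.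
Proof. by rewrite /winv map_cat rev_cat. Qed.

Lemma free_eq_winv u v : free_eq u v -> free_eq (winv u) (winv v).
Proof.
elim=> {u v} [u|u v _|v u w _ IH1 _ IH2|u v x b].
- exact: Free_refl.
- exact: Free_sym.
- exact: Free_trans IH1 IH2.
- rewrite !winv_cat -cat1s -[_ :: v]cat1s !winv_cat -!catA /= negbK.
  exact: Free_cancel.
Qed.

Lemma free_eq_mulV u : free_eq (u ++ winv u) [::].
Proof.
elim: u => [|[x b] u IH]; first exact: Free_refl.
rewrite -cat1s winv_cat catA -[(_ ++ u) ++ _]catA.
apply: (@Free_trans ([:: (x, b)] ++ [::] ++ winv [:: (x, b)])).
  rewrite -catA; apply: free_eq_cat; first exact: Free_refl.
  by apply: free_eq_cat => //; apply: Free_refl.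
exact: (@Free_cancel [::] [::]).
Qed.

Definition fmul (x y : free_group) : free_group :=
  \pi_free_group (repr x ++ repr y).
Definition finv (x : free_group) : free_group := \pi_free_group (winv (repr x)).
Definition fone : free_group := \pi_free_group [::].

Lemma free_repr u : free_eq (repr (\pi_free_group u)) u.
Proof. by apply/free_eqP; rewrite reprK. Qed.

Lemma pi_fmul u v :
  \pi_free_group (u ++ v) = fmul (\pi_free_group u) (\pi_free_group v).
Proof.
by apply/esym/free_eqP/free_eq_cat; apply: free_repr.
Qed.

Lemma pi_finv u : \pi_free_group (winv u) = finv (\pi_free_group u).
Proof. by apply/esym/free_eqP/free_eq_winv/free_repr. Qed.

Fact fmulA : associative fmul.
Proof.
elim/quotW=> u; elim/quotW=> v; elim/quotW=> w.
by rewrite -(pi_fmul v w) -(pi_fmul u v) -(pi_fmul u) -(pi_fmul _ w) catA.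
Qed.
Fact fmul1 : left_id fone fmul.
Proof. by elim/quotW=> u; rewrite -pi_fmul. Qed.
Fact fmulr1 : right_id fone fmul.
Proof. by elim/quotW=> u; rewrite -pi_fmul cats0. Qed.
Fact fmulrV : right_inverse fone finv fmul.
Proof.
elim/quotW=> u; rewrite -pi_finv -pi_fmul.
exact/free_eqP/free_eq_mulV.
Qed.
Fact fmulVr : left_inverse fone finv fmul.
Proof.
elim/quotW=> u; rewrite -pi_finv -pi_fmul.
by apply/free_eqP; rewrite -{2}[u]winvK; apply: free_eq_mulV.
Qed.

HB.instance Definition _ := isGroup.Build free_group fmulA fmul1 fmulr1
  fmulVr fmulrV.

Definition fgen (x : X) : free_group := \pi_free_group [:: (x, false)].

End FreeGroup.

Section FreeEval.
Variables (X : choiceType) (G : groupType) (x : X -> G).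

Definition weval (u : word X) : G :=
  \prod_(p <- u) (if p.2 then (x p.1)^-1 else x p.1).

Lemma weval_cat u v : weval (u ++ v) = weval u * weval v.
Proof. by rewrite /weval big_cat. Qed.

Lemma weval_free_eq u v : free_eq u v -> weval u = weval v.
Proof.
elim=> {u v} // [v u w _ -> //|u v y b]; rewrite !weval_cat /weval !big_cons /=.
by case: b => /=; rewrite ?mulKg ?mulVKg.
Qed.

Definition feval (u : free_group X) : G := weval (repr u).

Fact fevalM : {morph feval : u v / u * v}.
Proof.
by move=> u v; rewrite /feval -weval_cat; apply/weval_free_eq/free_repr.
Qed.

Fact feval1 : feval 1 = 1.
Proof. by rewrite /feval (weval_free_eq (free_repr _)) /weval big_nil. Qed.

HB.instance Definition _ :=
  isUMagmaMorphism.Build (free_group X) G feval (feval1, fevalM).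

Lemma feval_gen i : feval (fgen i) = x i.
Proof.
rewrite /feval (weval_free_eq (free_repr _)) /weval big_cons big_nil /=.
exact: mulg1.
Qed.

End FreeEval.

Definition fmap (X Y : choiceType) (f : X -> Y) : free_group X -> free_group Y :=
  feval (fun x => fgen (f x)).

(* In presentations, a relation u = v is given by the relator u / v = u * v^-1. *)
Section Presented.
Variables (X : choiceType) (R : set (free_group X)).

Definition pres_eqb (u v : free_group X) : bool :=
  `[< sg_set (normal_closure R) (u / v) >].

Lemma normal_closure_normalised : normalised (normal_closure R) setT.
Proof.
move=> u g Nu _ H [RH nH]; apply: (nH) => //.
exact: Nu.
Qed.

Let N := normal_closure R.
Let N1 : sg_set N 1. Proof. by case: (sg_setP N). Qed.
Let NF u v : sg_set N u -> sg_set N v -> sg_set N (u / v).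
Proof. by case: (sg_setP N) => _; apply. Qed.
Let NV u : sg_set N u -> sg_set N u^-1.
Proof. by move=> Nu; rewrite -[u^-1]mul1g; apply: NF. Qed.
Let NM u v : sg_set N u -> sg_set N v -> sg_set N (u * v).
Proof. by move=> Nu Nv; rewrite -[v]invgK; apply: NF => //; apply: NV. Qed.

Fact pres_eqb_refl : reflexive pres_eqb.
Proof. by move=> u; apply/asboolP; rewrite mulgV. Qed.
Fact pres_eqb_sym : symmetric pres_eqb.
Proof. by move=> u v; apply/asboolP/asboolP => /NV; rewrite invgF. Qed.
Fact pres_eqb_trans : transitive pres_eqb.
Proof.
move=> v u w /asboolP uv /asboolP vw; apply/asboolP.
by rewrite -(divgKA v); apply: NM.
Qed.

Canonical pres_eqb_equiv :=
  EquivRel pres_eqb pres_eqb_refl pres_eqb_sym pres_eqb_trans.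

Definition presented : Type := {eq_quot pres_eqb}.
HB.instance Definition _ := Choice.on presented.
HB.instance Definition _ := EqQuotient.on presented.

Lemma pres_eqP (u v : free_group X) :
  \pi_presented u = \pi v <-> sg_set (normal_closure R) (u / v).
Proof.
rewrite (rwP (@eqmodP _ pres_eqb_equiv u v)).
by split=> /asboolP.
Qed.

Definition pmul (a b : presented) : presented :=
  \pi_presented (repr a * repr b).
Definition pinv (a : presented) : presented := \pi_presented (repr a)^-1.
Definition pone : presented := \pi_presented 1.

Lemma pi_pmul u v :
  \pi_presented (u * v) = pmul (\pi_presented u) (\pi_presented v).
Proof.
have /pres_eqP uu : \pi_presented (repr (\pi_presented u)) = \pi u.
  by rewrite reprK.
have /pres_eqP vv : \pi_presented (repr (\pi_presented v)) = \pi v.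
  by rewrite reprK.
apply/esym/pres_eqP; set u' := repr _ in uu *; set v' := repr _ in vv *.
have -> : u' * v' / (u * v) = (u' / u) * (v' / v) ^ u^-1.
  by rewrite /conjg invgK invgM !mulgA mulgVK.
by apply: NM => //; apply: normal_closure_normalised.
Qed.

Lemma pi_pinv u : \pi_presented u^-1 = pinv (\pi_presented u).
Proof.
have /pres_eqP uu : \pi_presented u = \pi_presented (repr (\pi_presented u)).
  by rewrite reprK.
apply/pres_eqP; set u' := repr _ in uu *.
have -> : u^-1 / u'^-1 = ((u / u')^-1) ^ u.
  by rewrite /conjg invgF invgK mulgVK.
by apply: normal_closure_normalised => //; apply: NV.
Qed.

Fact pmulA : associative pmul.
Proof.
elim/quotW=> u; elim/quotW=> v; elim/quotW=> w.
by rewrite -(pi_pmul v w) -(pi_pmul u v) -(pi_pmul u) -(pi_pmul _ w) mulgA.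
Qed.
Fact pmul1 : left_id pone pmul.
Proof. by elim/quotW=> u; rewrite -pi_pmul mul1g. Qed.
Fact pmulr1 : right_id pone pmul.
Proof. by elim/quotW=> u; rewrite -pi_pmul mulg1. Qed.
Fact pmulVr : left_inverse pone pinv pmul.
Proof. by elim/quotW=> u; rewrite -pi_pinv -pi_pmul mulVg. Qed.
Fact pmulrV : right_inverse pone pinv pmul.
Proof. by elim/quotW=> u; rewrite -pi_pinv -pi_pmul mulgV. Qed.

HB.instance Definition _ := isGroup.Build presented pmulA pmul1 pmulr1
  pmulVr pmulrV.

Fact pi_presM u v :
  \pi_presented (u * v) = \pi_presented u * \pi_presented v.
Proof. exact: pi_pmul. Qed.

Definition pgen (x : X) : presented := \pi_presented (fgen x).

End Presented.

Section PresentedLift.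
Variables (X : choiceType) (R : set (free_group X)) (G : groupType) (x : X -> G).
Hypothesis Rx : R `<=` kersg (feval x).

Definition plift of R `<=` kersg (feval x) :=
  fun a : presented R => feval x (repr a).

Lemma plift_pi u : plift Rx (\pi u) = feval x u.
Proof.
rewrite /plift; set u' := repr _.
have /pres_eqP uu : \pi_(presented R) u' = \pi u by rewrite reprK.
have /uu /= : R `<=` kersg (feval x) /\ normalised (kersg (feval x)) setT.
  split=> // v g /= v1 _.
  by rewrite gmulfJ /= v1 conj1g.
by rewrite gmulfF => /divg1_eq.
Qed.

Fact pliftM : {morph plift Rx : a b / a * b}.
Proof.
elim/quotW=> u; elim/quotW=> v; rewrite -pi_presM !plift_pi.
exact: gmulfM.
Qed.

Fact plift1 : plift Rx 1 = 1.
Proof. by rewrite plift_pi gmulf1. Qed.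

HB.instance Definition _ :=
  isUMagmaMorphism.Build (presented R) G (plift Rx) (plift1, pliftM).

Lemma plift_gen i : plift Rx (pgen R i) = x i.
Proof. by rewrite plift_pi feval_gen. Qed.

End PresentedLift.

(* H = < x_i, i in X | R >, for a family x of elements of the ambient group. *)
Definition has_presentation (X : choiceType) (T : groupType) (H : subgroup T)
    (x : X -> T) (R : set (free_group X)) :=
  gensg (range x) = H :> set T /\
  kersg (feval x) = normal_closure R :> set (free_group X).

Definition free_product_relators (G H : groupType) : set (free_group (G + H)%type) :=
  (fmap inl @` kersg (feval (@id G))) `|` (fmap inr @` kersg (feval (@id H))).
Definition free_product (G H : groupType) := presented (@free_product_relators G H).

Section HNN.
Variables (T : groupType) (H K A B : subgroup T) (phi : {multiplicative A -> B}).
Variable t : T.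

Definition hnn_gen (k : option K) : T := if k is Some k' then val k' else t.

(* The generators are the elements of K together with the stable letter, which
   is None; the relators are rel(K) and t^-1 a t / phi(a) for a in A. *)
Definition hnn_relators : set (free_group (option K)) :=
  (fmap Some @` kersg (feval (@id K))) `|`
  [set r | exists (a : A) (k l : K), [/\ val k = val a, val l = val (phi a)
     & r = fgen (Some k) ^ fgen None / fgen (Some l)]].

Definition is_HNN_extension :=
  [/\ A `<=` K, B `<=` K, bijective phi
    & has_presentation H hnn_gen hnn_relators].

End HNN.

Inductive sg_gen := Sigma1 | Sigma2 | Tau1 | Tau2.
HB.instance Definition _ := gen_eqMixin sg_gen.
HB.instance Definition _ := gen_choiceMixin sg_gen.

Definition SG3_relators : set (free_group sg_gen) :=
  let s1 := fgen Sigma1 in let s2 := fgen Sigma2 in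
  let t1 := fgen Tau1 in let t2 := fgen Tau2 in
  [set` [:: s1 * s2 * s1 / (s2 * s1 * s2);
            s1 * t1 / (t1 * s1);
            s2 * t2 / (t2 * s2);
            s1 * s2 * t1 / (t2 * s1 * s2);
            s2 * s1 * t2 / (t1 * s2 * s1)]].

Definition SG3 := presented SG3_relators.
HB.instance Definition _ := Group.on SG3.

Definition sigma1 : SG3 := pgen SG3_relators Sigma1.
Definition sigma2 : SG3 := pgen SG3_relators Sigma2.
Definition tau1 : SG3 := pgen SG3_relators Tau1.
Definition tau2 : SG3 := pgen SG3_relators Tau2.

(* The points 1, 2, 3 permuted by S_3 are 0, 1, 2 : 'I_3. *)
Definition pi_gen (x : sg_gen) : 'S_3 :=
  match x with
  | Sigma1 | Tau1 => tperm (inord 0) (inord 1)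
  | Sigma2 | Tau2 => tperm (inord 1) (inord 2)
  end.

Fact pi_gen_relators : SG3_relators `<=` kersg (feval pi_gen).
Proof.
have E : pi_gen Sigma1 * pi_gen Sigma2 * pi_gen Sigma1 =
         pi_gen Sigma2 * pi_gen Sigma1 * pi_gen Sigma2.
  apply/permP => i; rewrite !permM /= !permE /=.
  have iP j k : j < 3 -> k < 3 -> (@inord 2 j == inord k) = (j == k).
    by move=> j3 k3; rewrite -val_eqE /= !inordK.
  by rewrite -[i]inord_val; case: i => -[|[|[|//]]] ? /=;
    rewrite !iP //=; do ?rewrite !iP //=.
have D (u v : free_group sg_gen) :
    feval pi_gen u = feval pi_gen v -> feval pi_gen (u / v) = 1.
  by move=> uv; rewrite gmulfF /= uv mulgV.
move=> r; rewrite /SG3_relators /= !inE.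
by do ?case/orP; move=> /eqP ->; apply: D;
  rewrite !gmulfM /= !feval_gen.
Qed.

Definition pi_SG3 : {multiplicative SG3 -> 'S_3} := plift pi_gen_relators.

Definition SP3 : subgroup SG3 := kersg pi_SG3.

Definition a12 : SG3 := sigma1 ^+ 2.
Definition a13 : SG3 := sigma2 * sigma1 ^+ 2 * sigma2^-1.
Definition a23 : SG3 := sigma2 ^+ 2.
Definition b12 : SG3 := sigma1 * tau1.
Definition b13 : SG3 := sigma2 * sigma1 * tau1 * sigma2^-1.
Definition b23 : SG3 := sigma2 * tau2.

Definition V3 : subgroup SG3 := gensg [set a13; a23; b13; b23].
Definition V3t : subgroup SG3 := gensg (V3 `|` [set b12]).

Inductive V3_gen := A13 | A23 | B13 | B23.
HB.instance Definition _ := gen_eqMixin V3_gen.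
HB.instance Definition _ := gen_choiceMixin V3_gen.

Definition V3_elt (x : V3_gen) : SG3 :=
  match x with A13 => a13 | A23 => a23 | B13 => b13 | B23 => b23 end.

(* The additional generator None stands for b12. *)
Definition V3t_elt (x : option V3_gen) : SG3 :=
  if x is Some y then V3_elt y else b12.

Definition V3_relators : set (free_group V3_gen) :=
  [set [~ fgen A13, fgen B13]; [~ fgen A23, fgen B23]].

Definition V3t_relators : set (free_group (option V3_gen)) :=
  [set [~ fgen (Some A13), fgen (Some B13)];
       [~ fgen (Some A23), fgen (Some B23)];
       [~ fgen (Some A13) * fgen (Some A23), fgen None]].

Definition V3t_hnn_relators : set (free_group (option V3_gen)) :=
  (fmap Some @` kersg (feval V3_elt)) `|`
  [set (fgen None)^-1 * (fgen (Some A13) * fgen (Some A23)) * fgen None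
       / (fgen (Some A13) * fgen (Some A23))].

Definition Zgroup : groupType := Algebra.to_multiplicative int.

(* Main.v *)
Require Import Defs.
From HB Require Import structures.
From mathcomp Require Import all_boot perm ssralg ssrnum ssrint.
From mathcomp Require Import boolp classical_sets.

Set Implicit Arguments.
Unset Strict Implicit.
Unset Printing Implicit Defensive.

Local Open Scope group_scope.
Local Open Scope classical_set_scope.
Local Open Scope quotient_scope.

(** Everything rests on one normal form. Let P be the abstract group with the
    presentation claimed for V3t, and let P -> SG3 send its generators to the
    a_ij and b_ij; this is well defined because the three relations hold in SG3
    (V3t_elt_rel). The subgroup of SG3 whose image in S_3 fixes the last point
    has index 3, with right coset representatives 1, sigma2 and sigma2 sigma1,
    and it should be the semidirect product of V3t and the infinite cyclic group
    generated by sigma1. So every element of SG3 ought to be, in exactly one way,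
    sigma1^n w r with n an integer, w in P and r one of the representatives.

    This is proved as in the Reidemeister-Schreier method, by letting SG3 act on
    the set of candidate triples (n, w, r) as right multiplication would. The
    formulas for the action only use the conjugation by sigma1, which makes sense
    as an automorphism of P (shift), since it maps the generators to words in the
    generators. It is convenient to replace tau_i by sigma_i tau_i
    (SG3_pair_relations): these elements multiply w on the right and change
    neither n nor r. Once the relations of SG3 are checked on triples, there are
    two consequences. The map from triples to SG3 commutes with right
    multiplication and its image contains 1, so it is onto (SG3_normal_form).
    The image of w in P takes the triple (0, 1, 1) to (0, w, 1), so P embeds in
    SG3 (V3t_map_inj), which is the presentation of V3t.

    The rest follows formally. Killing b12 retracts P onto the group presented
    by [a13, b13] = [a23, b23] = 1, so that these relations define V3, and this
    group is visibly Z^2 * Z^2. The two HNN presentations have the same content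
    as the presentation by [a13, b13], [a23, b23] and [a13 a23, b12], up to
    the introduction of redundant generators and relations of V3
    (presentation_transfer). Finally, an element sigma1^n w r of the normal form
    is pure exactly when n is even and r = 1, in which case it lies in
    V3t <a12>; and the action shows that a power of a12 that lies in V3t is
    trivial. *)

(** * Subgroups and homomorphisms *)

Section SubgroupTheory.
Variables (G : groupType) (H : subgroup G).

Lemma subgroup1 : sg_set H 1.
Proof. by case: (sg_setP H). Qed.

Lemma subgroupF x y : sg_set H x -> sg_set H y -> sg_set H (x / y).
Proof. by case: (sg_setP H) => _; apply. Qed.

Lemma subgroupV x : sg_set H x -> sg_set H x^-1.
Proof. by move=> Hx; rewrite -div1g; apply: subgroupF => //; apply: subgroup1. Qed.

Lemma subgroupM x y : sg_set H x -> sg_set H y -> sg_set H (x * y).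
Proof.
by move=> Hx Hy; rewrite -[y]invgK; apply: subgroupF => //; apply: subgroupV.
Qed.

End SubgroupTheory.

Lemma sub_gensg (G : groupType) (A : set G) : A `<=` gensg A.
Proof. by move=> x Ax H AH; apply: AH. Qed.

Lemma gensg_min (G : groupType) (A : set G) (H : subgroup G) :
  A `<=` H -> gensg A `<=` H.
Proof. by move=> AH x; apply. Qed.

Lemma sub_normal_closure {G : groupType} (A : set G) : A `<=` normal_closure A.
Proof. by move=> x Ax H [AH _]; apply: AH. Qed.

Lemma normal_closure_ker {G K : groupType} {A : set G} {f : UMagmaMorphism.type G K} :
  A `<=` kersg f -> normal_closure A `<=` kersg f.
Proof.
move=> Af x; apply; split=> // y g /= fy _.
by rewrite gmulfJ /= fy conj1g.
Qed.

Fact range_subgroup {G K : groupType} (f : UMagmaMorphism.type G K) :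
  is_subgroup (range f).
Proof.
split; first by exists 1; rewrite ?gmulf1.
by move=> _ _ [x _ <-] [y _ <-]; exists (x / y); rewrite ?gmulfF.
Qed.

Definition imsg {G K : groupType} (f : UMagmaMorphism.type G K) : subgroup K :=
  Subgroup (range_subgroup f).

Section Hom.
Variables (G K : groupType) (f : G -> K) (fM : {morph f : x y / x * y}).

Fact morph1 : f 1 = 1.
Proof. by apply: (@mulgI _ (f 1)); rewrite -fM !mulg1. Qed.

Definition hom : UMagmaMorphism.type G K :=
  HB.pack f (isUMagmaMorphism.Build G K f (morph1, fM)).

End Hom.

Lemma isog_sym {G K : groupType} : isog G K -> isog K G.
Proof.
case=> f [g fK gK].
by exists (hom (can2_gmulfM fK gK)); exists f.
Qed.

Lemma isog_trans {G K L : groupType} : isog G K -> isog K L -> isog G L.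
Proof. by move=> [f fb] [g gb]; exists (g \o f); apply: bij_comp. Qed.

(** * Free groups and presentations *)

Section FreeInduction.
Variable X : choiceType.

(** Closure under division makes one hypothesis cover products and inverses. *)
Lemma free_ind (P : free_group X -> Prop) :
  P 1 -> (forall u v, P u -> P v -> P (u / v)) -> (forall x, P (fgen x)) ->
  forall u, P u.
Proof.
move=> P1 PF Pg; elim/quotW; elim=> [|[x b] u IH]; first exact: P1.
have PV v : P v -> P v^-1 by rewrite -div1g; apply: PF.
rewrite -cat1s (pi_fmul [:: (x, b)] u) -[\pi u]invgK.
apply: PF; last exact: PV.
case: b; last exact: Pg.
have -> : \pi [:: (x, true)] = (fgen x)^-1 := pi_finv [:: (x, false)].
exact: PV.
Qed.

Lemma free_ext (G : groupType) (f g : UMagmaMorphism.type (free_group X) G) :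
  (forall x, f (fgen x) = g (fgen x)) -> f =1 g.
Proof.
move=> fg; apply: free_ind => //; first by rewrite !gmulf1.
by move=> u v fgu fgv; rewrite !gmulfF /= fgu fgv.
Qed.

Lemma feval_comp (G K : groupType) (x : X -> G) (h : UMagmaMorphism.type G K) u :
  feval (h \o x) u = h (feval x u).
Proof.
by apply: (@free_ext _ (feval (h \o x)) (h \o feval x)) => i /=; rewrite !feval_gen.
Qed.

Lemma feval_fmap (Y : choiceType) (G : groupType) (f : X -> Y) (y : Y -> G) u :
  feval y (fmap f u) = feval (y \o f) u.
Proof.
apply: (@free_ext _ (feval y \o feval (fun x => fgen (f x))) (feval (y \o f))) => x /=.
by rewrite !feval_gen.
Qed.

Lemma gensg_range (G : groupType) (x : X -> G) :
  gensg (range x) = range (feval x) :> set G.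
Proof.
rewrite eqEsubset; split=> [|_ [u _ <-]].
  apply: (@gensg_min _ _ (imsg (feval x))) => _ [i _ <-] /=.
  by exists (fgen i); rewrite ?feval_gen.
elim/free_ind: u => [|u v Hu Hv|i].
- by rewrite gmulf1; apply: subgroup1.
- by rewrite gmulfF; apply: subgroupF.
- by rewrite feval_gen; apply: sub_gensg; exists i.
Qed.

End FreeInduction.

HB.instance Definition _ (X Y : choiceType) (f : X -> Y) :=
  UMagmaMorphism.copy (fmap f) (feval (fun x => fgen (f x))).

Section PresentedTheory.
Variables (X : choiceType) (R : set (free_group X)).

Fact pi_pres1 : \pi_(presented R) 1 = 1.
Proof. by []. Qed.

Lemma pi_presE u : \pi_(presented R) u = feval (pgen R) u.
Proof.
elim/free_ind: u => [|u v Hu Hv|x]; last by rewrite feval_gen.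
  by rewrite gmulf1.
rewrite gmulfF pi_presM /= -Hu -Hv; congr (_ * _).
exact: pi_pinv.
Qed.

Lemma pres_rel_eq1 (u : free_group X) :
  sg_set (normal_closure R) u -> feval (pgen R) u = 1.
Proof. by move=> Ru; rewrite -pi_presE -pi_pres1; apply/pres_eqP; rewrite divg1. Qed.

Lemma pres_eq1_rel (u : free_group X) :
  feval (pgen R) u = 1 -> sg_set (normal_closure R) u.
Proof. by rewrite -pi_presE -pi_pres1 => /pres_eqP; rewrite divg1. Qed.

Lemma pres_surj (a : presented R) : exists u, a = feval (pgen R) u.
Proof. by exists (repr a); rewrite -pi_presE reprK. Qed.

Lemma pres_ind (P : presented R -> Prop) :
  P 1 -> (forall u v, P u -> P v -> P (u / v)) -> (forall x, P (pgen R x)) ->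
  forall u, P u.
Proof.
move=> P1 PF Pg a; have [u ->] := pres_surj a.
elim/free_ind: u => [|u v Hu Hv|x]; last by rewrite feval_gen.
  by rewrite gmulf1.
by rewrite gmulfF; apply: PF.
Qed.

Lemma pres_ext (G : groupType) (f g : UMagmaMorphism.type (presented R) G) :
  (forall x, f (pgen R x) = g (pgen R x)) -> f =1 g.
Proof.
move=> fg; apply: pres_ind => //; first by rewrite !gmulf1.
by move=> u v fgu fgv; rewrite !gmulfF /= fgu fgv.
Qed.

Lemma plift_feval (G : groupType) (x : X -> G) (Rx : R `<=` kersg (feval x)) u :
  plift Rx (feval (pgen R) u) = feval x u.
Proof. by rewrite -pi_presE plift_pi. Qed.

End PresentedTheory.

Lemma inj_surj_bij (S T : Type) (f : S -> T) :
  injective f -> (forall y, exists x, f x = y) -> bijective f.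
Proof.
move=> fI fS; pose g y := projT1 (cid (fS y)).
have gK : cancel g f by move=> y; rewrite /g; case: cid.
by exists g => // x; apply: fI; rewrite gK.
Qed.

Section Presentation.
Variables (X : choiceType) (T : groupType) (H : subgroup T).
Variables (x : X -> T) (R : set (free_group X)).

Lemma presentationP :
  gensg (range x) = H :> set T -> R `<=` kersg (feval x) ->
  (forall u, feval x u = 1 -> feval (pgen R) u = 1) ->
  has_presentation H x R.
Proof.
move=> xH Rx xR; split=> //; rewrite eqEsubset; split; last exact: normal_closure_ker.
by move=> u /xR/pres_eq1_rel.
Qed.

Hypothesis pH : has_presentation H x R.

Lemma presentation_rel : R `<=` kersg (feval x).
Proof. by case: pH => _ ->; apply: sub_normal_closure. Qed.

(** Von Dyck: a presentation of H gives homomorphisms out of H, stated on words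
    so that no map on the subgroup H has to be formed. *)
Lemma presentation_eq1 (K : groupType) (z : X -> K) (Rz : R `<=` kersg (feval z)) u :
  feval x u = 1 -> feval z u = 1.
Proof.
case: pH => _ kE x1; have : sg_set (kersg (feval x)) u by [].
by rewrite kE; apply: normal_closure_ker.
Qed.

Lemma presentation_gen g : sg_set H g -> exists u, feval x u = g.
Proof. by case: pH => <- _; rewrite gensg_range => -[u _ <-]; exists u. Qed.

Lemma isog_presented : isog (presented R) H.
Proof.
have xH i : x i \in sg_set H.
  by rewrite inE; case: pH => <- _; apply: sub_gensg; exists i.
pose y i : H := Sub (x i) (xH i).
have yx u : val (feval y u) = feval x u by rewrite -(feval_comp _ val).
have Ry : R `<=` kersg (feval y).
  by move=> r Rr; apply/val_inj; rewrite yx val1; apply: presentation_rel.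
exists (plift Ry); apply: inj_surj_bij => [|h].
  apply: gmulf_inj => a; have [u ->] := pres_surj a; rewrite /= plift_feval => y1.
  apply: (presentation_eq1 (z := pgen R)).
    by move=> r /sub_normal_closure/pres_rel_eq1.
  by rewrite -yx y1 val1.
have [|u uh] := @presentation_gen (val h); first by have := valP h; rewrite inE.
by exists (feval (pgen R) u); apply/val_inj; rewrite -uh -yx /= plift_feval.
Qed.

End Presentation.

(** The counterpart of Tietze transformations. The map z is a candidate inverse
    of the canonical map from the group presented by S to H; the last hypothesis
    says that it is one on generators, so that each word v in the y_j may be
    replaced by a word u in the x_i with the same value in H and the same class
    modulo S. *)
Lemma presentation_transfer (X Y : choiceType) (T : groupType) (H : subgroup T)
    (x : X -> T) (R : set (free_group X)) (y : Y -> T) (S : set (free_group Y))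
    (z : X -> presented S) :
  has_presentation H x R ->
  gensg (range y) = H :> set T -> S `<=` kersg (feval y) ->
  R `<=` kersg (feval z) ->
  (forall j, exists2 u, feval x u = y j & feval z u = pgen S j) ->
  has_presentation H y S.
Proof.
move=> pH yH Sy Rz yz; apply: presentationP => // v y1.
have [u xu <-] : exists2 u, feval x u = feval y v & feval z u = feval (pgen S) v.
  elim/free_ind: v {y1} => [|v w [u xu zu] [u' xu' zu']|j].
  - by exists 1; rewrite !gmulf1.
  - by exists (u / u'); rewrite !gmulfF /= ?xu ?xu' ?zu ?zu'.
  - by rewrite !feval_gen; apply: yz.
by apply: (presentation_eq1 pH) => //; rewrite xu.
Qed.

(** When a group K sits in a presentation through all its elements and all its
    relations, as the base of an HNN extension or a free factor does, the
    generators that come from K multiply as in K. *)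
Lemma pgen_group_rel (K : groupType) (Y : choiceType) (f : K -> Y)
    (S : set (free_group Y)) (fS : fmap f @` kersg (feval (@id K)) `<=` S) u :
  feval (pgen S \o f) u = pgen S (f (feval id u)).
Proof.
(* The word u and the one-letter word of its value differ by a relation of K. *)
have : feval (pgen S) (fmap f (u / fgen (feval id u))) = 1.
  apply/pres_rel_eq1/sub_normal_closure/fS; exists (u / fgen (feval id u)) => //=.
  by rewrite gmulfF /= feval_gen mulgV.
by rewrite feval_fmap gmulfF /= feval_gen => /divg1_eq.
Qed.

Lemma pgen_groupM (K : groupType) (Y : choiceType) (f : K -> Y)
    (S : set (free_group Y)) (fS : fmap f @` kersg (feval (@id K)) `<=` S) :
  {morph pgen S \o f : k l / k * l}.
Proof.
move=> k l; have := pgen_group_rel fS (fgen k * fgen l).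
by rewrite !gmulfM /= !feval_gen.
Qed.

(** * Integer powers and permutations of a type *)

Lemma int_step_ind (P : int -> Prop) :
  P 0%R -> (forall n, P n -> P (n + 1)%R) -> (forall n, P n -> P (n - 1)%R) ->
  forall n, P n.
Proof.
move=> P0 PS PP; elim=> // n IH; last rewrite intS GRing.opprD GRing.addrC.
  by rewrite intS GRing.addrC; apply: PS.
exact: PP.
Qed.

Section IntegerPowers.
Variables (G : groupType) (g : G).

Definition zpow (n : int) : G :=
  match n with Posz m => g ^+ m | Negz m => g ^- m.+1 end.

Lemma zpowS n : zpow (n + 1)%R = zpow n * g.
Proof.
case: n => [n|[|n]].
- by rewrite GRing.addrC -intS /= expgSr.
- by rewrite /= expg1 mulVg.
- have -> : (Negz n.+1 + 1 = Negz n)%R.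
    by rewrite !NegzE intS GRing.opprD GRing.addrAC GRing.addNr GRing.add0r.
  by rewrite /= (expgS _ n.+1) invgM mulgVK.
Qed.

Lemma zpow_pred n : zpow (n - 1)%R = zpow n / g.
Proof. by rewrite -[n in RHS](GRing.subrK 1%R) zpowS mulgK. Qed.

Fact zpowM : {morph (zpow : Zgroup -> G) : m n / m * n}.
Proof.
move=> m n; change (m * n) with (m + n)%R.
elim/int_step_ind: n => [|n IH|n IH].
- by rewrite GRing.addr0 mulg1.
- by rewrite GRing.addrA !zpowS IH mulgA.
- by rewrite GRing.addrA !zpow_pred IH mulgA.
Qed.

HB.instance Definition _ :=
  isUMagmaMorphism.Build Zgroup G (zpow : Zgroup -> G) (erefl, zpowM).

End IntegerPowers.

Lemma zpow_mono (G K : groupType) (f : UMagmaMorphism.type G K) (g : G) n :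
  f (zpow g n) = zpow (f g) n.
Proof. by case: n => n /=; rewrite ?gmulfV gmulfXn. Qed.

Lemma zpow_sqr (G : groupType) (g : G) n : zpow (g ^+ 2) n = zpow g (n + n)%R.
Proof.
elim/int_step_ind: n => [|n IH|n IH] //.
  by rewrite GRing.addrACA GRing.addrA !zpowS IH mulgA.
by rewrite GRing.addrACA GRing.addrA !zpow_pred IH /= invgM mulgA.
Qed.

Lemma gensg1E (G : groupType) (g : G) : gensg [set g] = range (zpow g) :> set G.
Proof.
rewrite eqEsubset; split=> [|_ [n _ <-]].
  by apply: (@gensg_min _ _ (imsg (zpow g : Zgroup -> G))) => _ ->; exists 1%R.
have gg : sg_set (gensg [set g]) g by apply: sub_gensg.
elim/int_step_ind: n => [|n IH|n IH].
- exact: subgroup1.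
- by rewrite zpowS; apply: subgroupM.
- by rewrite zpow_pred; apply: subgroupF.
Qed.

Lemma commute_zpow (G : groupType) (x g : G) n : commute x g -> commute x (zpow g n).
Proof. by case: n => n xg /=; [|apply: commuteV]; apply: commuteX. Qed.

Lemma zpow1n (G : groupType) n : zpow (1 : G) n = 1.
Proof.
elim/int_step_ind: n => [|n IH|n IH] //.
  by rewrite zpowS IH mulg1.
by rewrite zpow_pred IH divg1.
Qed.

Fact zpow2M (G : groupType) (a b : G) (ab : commute a b) :
  {morph (fun k : (Zgroup * Zgroup)%type => zpow a k.1 * zpow b k.2) : k l / k * l}.
Proof.
move=> [m n] [m' n'] /=; rewrite !zpowM -!mulgA; congr (_ * _).
rewrite !mulgA; congr (_ * _).
by apply/commute_sym/commute_zpow/commute_sym/commute_zpow.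
Qed.

Lemma int_parity (n : int) : exists m, n = (m + m)%R \/ n = (m + m + 1)%R.
Proof.
elim/int_step_ind: n => [|n [m [->|->]]|n [m [->|->]]]; first by exists 0%R; left.
- by exists m; right.
- exists (m + 1)%R; left.
  by rewrite -[in RHS]GRing.addrA [(1 + _)%R in RHS]GRing.addrC !GRing.addrA.
- exists (m - 1)%R; right; rewrite GRing.addrA GRing.subrK.
  by rewrite GRing.addrAC.
- by exists m; left; rewrite GRing.addrK.
Qed.

(** A permutation is a pair of mutually inverse functions, multiplied from left
    to right, as the action of a group on its right cosets requires. *)
Section Permutations.
Variable T : Type.

Record permutation := Permutation {
  pfun :> T -> T;
  pfun_inv : T -> T;
  pfunK : cancel pfun pfun_inv;
  pfunVK : cancel pfun_inv pfun }.

Lemma permutation_ext (f g : permutation) : f =1 g -> f = g.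
Proof.
case: f g => [f f' fK f'K] [g g' gK g'K] /= /funext fg; case: g / fg in gK g'K *.
have fg' : f' = g' by apply/funext => y; rewrite -[y in f' y]g'K fK.
by case: g' / fg' in gK g'K *; congr Permutation; apply: Prop_irrelevance.
Qed.

HB.instance Definition _ := gen_eqMixin permutation.
HB.instance Definition _ := gen_choiceMixin permutation.

Definition perm_mul (f g : permutation) : permutation :=
  Permutation (can_comp (pfunK g) (pfunK f)) (can_comp (pfunVK f) (pfunVK g)).
Definition perm_one : permutation := @Permutation id id (fun=> erefl) (fun=> erefl).
Definition perm_inv (f : permutation) : permutation := Permutation (pfunVK f) (pfunK f).

Fact perm_mulA : associative perm_mul.
Proof. by move=> f g h; apply: permutation_ext. Qed.
Fact perm_mul1 : left_id perm_one perm_mul.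
Proof. by move=> f; apply: permutation_ext. Qed.
Fact perm_mulr1 : right_id perm_one perm_mul.
Proof. by move=> f; apply: permutation_ext. Qed.
Fact perm_mulV : left_inverse perm_one perm_inv perm_mul.
Proof. by move=> f; apply: permutation_ext => x /=; apply: pfunVK. Qed.
Fact perm_mulrV : right_inverse perm_one perm_inv perm_mul.
Proof. by move=> f; apply: permutation_ext => x /=; apply: pfunK. Qed.

HB.instance Definition _ :=
  isGroup.Build permutation perm_mulA perm_mul1 perm_mulr1 perm_mulV perm_mulrV.

End Permutations.

(** * The singular braid group generated by sigma_i and sigma_i tau_i *)

Lemma relator_eq (X : choiceType) (G : groupType) (x : X -> G) (u v : free_group X) :
  sg_set (kersg (feval x)) (u / v) <-> feval x u = feval x v.
Proof.
rewrite /= gmulfF /=; split=> [/divg1_eq //|->]; exact: mulgV.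
Qed.

Lemma SG3_relatorsP (G : groupType) (x : sg_gen -> G) :
  let s1 := x Sigma1 in let s2 := x Sigma2 in
  let t1 := x Tau1 in let t2 := x Tau2 in
  SG3_relators `<=` kersg (feval x) <->
  [/\ s1 * s2 * s1 = s2 * s1 * s2, s1 * t1 = t1 * s1, s2 * t2 = t2 * s2,
      s1 * s2 * t1 = t2 * s1 * s2 & s2 * s1 * t2 = t1 * s2 * s1].
Proof.
move=> s1 s2 t1 t2; split=> [Rx|[r1 r2 r3 r4 r5] r].
  have rel u v : SG3_relators (u / v) -> feval x u = feval x v by move=> /Rx/relator_eq.
  split.
  - have := rel (fgen Sigma1 * fgen Sigma2 * fgen Sigma1)
              (fgen Sigma2 * fgen Sigma1 * fgen Sigma2).
    by rewrite !gmulfM /= !feval_gen; apply; rewrite /SG3_relators /= !inE eqxx.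
  - have := rel (fgen Sigma1 * fgen Tau1) (fgen Tau1 * fgen Sigma1).
    by rewrite !gmulfM /= !feval_gen; apply; rewrite /SG3_relators /= !inE eqxx ?orbT.
  - have := rel (fgen Sigma2 * fgen Tau2) (fgen Tau2 * fgen Sigma2).
    by rewrite !gmulfM /= !feval_gen; apply; rewrite /SG3_relators /= !inE eqxx ?orbT.
  - have := rel (fgen Sigma1 * fgen Sigma2 * fgen Tau1)
              (fgen Tau2 * fgen Sigma1 * fgen Sigma2).
    by rewrite !gmulfM /= !feval_gen; apply; rewrite /SG3_relators /= !inE eqxx ?orbT.
  - have := rel (fgen Sigma2 * fgen Sigma1 * fgen Tau2)
              (fgen Tau1 * fgen Sigma2 * fgen Sigma1).
    by rewrite !gmulfM /= !feval_gen; apply; rewrite /SG3_relators /= !inE eqxx ?orbT.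
by rewrite /SG3_relators /= !inE; do ?case/orP; move=> /eqP ->;
  apply/relator_eq; rewrite !gmulfM /= !feval_gen.
Qed.

(** Here b_i stands for sigma_i tau_i. Commuting with sigma_i is the same for
    tau_i as for b_i; and the braid relation says that sigma1 sigma2 conjugates
    sigma1 to sigma2, so it conjugates tau1 to tau2 if and only if it conjugates
    b1 to b2; the last relation is the same with the indices exchanged. *)
Lemma SG3_pair_relations (G : groupType) (s1 s2 b1 b2 : G) :
  let t1 := s1^-1 * b1 in let t2 := s2^-1 * b2 in
  s1 * s2 * s1 = s2 * s1 * s2 ->
  [/\ s1 * t1 = t1 * s1, s2 * t2 = t2 * s2,
      s1 * s2 * t1 = t2 * s1 * s2 & s2 * s1 * t2 = t1 * s2 * s1] <->
  [/\ s1 * b1 = b1 * s1, s2 * b2 = b2 * s2,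
      s1 * s2 * b1 = b2 * s1 * s2 & s2 * s1 * b2 = b1 * s2 * s1].
Proof.
have comm (s b : G) : s * (s^-1 * b) = s^-1 * b * s <-> s * b = b * s.
  by rewrite mulVKg -mulgA; split=> [e|<-]; [rewrite {1}e mulVKg | rewrite mulKg].
have conj (s s' b b' : G) : s * s' * s = s' * s * s' ->
    s * s' * (s^-1 * b) = s'^-1 * b' * s * s' <-> s * s' * b = b' * s * s'.
  move=> br; have -> : s * s' * (s^-1 * b) = s'^-1 * (s * s' * b).
    by apply: (mulgI s'); rewrite mulVKg !mulgA -br mulgK.
  by rewrite -!mulgA; split=> [/mulgI|->].
move=> t1 t2 br; split.
  by case=> /comm ? /comm ? /(conj _ _ _ _ br) ? /(conj _ _ _ _ (esym br)).
by case=> /comm ? /comm ? /(conj _ _ _ _ br) ? /(conj _ _ _ _ (esym br)).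
Qed.

Lemma sigma_braid : sigma1 * sigma2 * sigma1 = sigma2 * sigma1 * sigma2.
Proof.
have /SG3_relatorsP[] // : SG3_relators `<=` kersg (feval (pgen SG3_relators)).
by move=> r /sub_normal_closure/pres_rel_eq1.
Qed.

Lemma b_relations :
  [/\ sigma1 * b12 = b12 * sigma1, sigma2 * b23 = b23 * sigma2,
      sigma1 * sigma2 * b12 = b23 * sigma1 * sigma2
    & sigma2 * sigma1 * b23 = b12 * sigma2 * sigma1].
Proof.
apply/(SG3_pair_relations _ _ sigma_braid); rewrite !mulKg.
have /SG3_relatorsP[] // : SG3_relators `<=` kersg (feval (pgen SG3_relators)).
by move=> r /sub_normal_closure/pres_rel_eq1.
Qed.

Lemma a13E : a13 = (sigma1 ^+ 2) ^ sigma2^-1.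
Proof. by rewrite conjgE invgK mulgA. Qed.

Lemma b13E : b13 = b12 ^ sigma2^-1.
Proof. by rewrite conjgE invgK /b13 /b12 !mulgA. Qed.

Lemma a13a23E : a13 * a23 = sigma2 * sigma1 * (sigma1 * sigma2).
Proof. by rewrite /a13 /a23 !expg2 !mulgA mulgVK. Qed.

(** The full twist (sigma1 sigma2 sigma1)^2 = a12 a13 a23 is central, so a13 a23
    commutes with whatever commutes with a12 = sigma1^2. *)
Lemma commute_a13a23_sigma1 : commute (a13 * a23) sigma1.
Proof.
rewrite /commute a13a23E -(mulgA (sigma2 * sigma1)) sigma_braid.
by rewrite !mulgA -sigma_braid.
Qed.

Lemma commute_a13a23_b12 : commute (a13 * a23) b12.
Proof.
rewrite /commute a13a23E; have [_ _] := b_relations.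
by move: b12 b23 => b c b1 b2; rewrite -(mulgA (sigma2 * sigma1)) b1 !mulgA b2.
Qed.

(** This lemma and the next three, with the fact that sigma1 commutes with b12,
    express the conjugate of each generator of V3t by sigma1 as a word in the
    generators. *)
Lemma sigma1_a13 : sigma1 * a13 = a23 * sigma1.
Proof.
apply: (mulIg sigma2); rewrite /a13 /a23 !expg2 !mulgA mulgVK sigma_braid.
by rewrite -!mulgA; congr (_ * _); rewrite !mulgA sigma_braid.
Qed.

Lemma sigma1_b13 : sigma1 * b13 = b23 * sigma1.
Proof.
rewrite b13E conjgE invgK; have [_ _ b1 _] := b_relations.
by move: b12 b23 b1 => b c b1; rewrite !mulgA b1 mulgK.
Qed.

Lemma sigma1_a23J : sigma1 * (a23 ^ a13^-1) = a13 * sigma1.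
Proof.
have := sigma1_a13; have := commute_a13a23_sigma1; rewrite conjgE invgK.
move: a13 a23 => x y xy sx.
by rewrite [x * (y / x)]mulgA mulgA -xy -(mulgA x) -sx !mulgA mulgK.
Qed.

Lemma sigma1_b23J : sigma1 * (b23 ^ a13^-1) = b13 * sigma1.
Proof.
have e : a23 * sigma1 * b23 = b13 * (a23 * sigma1).
  have [_ _ _] := b_relations; rewrite b13E conjgE invgK /a23 expg2.
  move: b12 b23 => b c e; rewrite -!mulgA mulKg.
  by rewrite [in LHS](mulgA sigma2 sigma1) e !mulgA.
have := sigma1_a13; rewrite conjgE invgK.
by move: a13 a23 b13 b23 e => x y b c e sx; rewrite !mulgA sx e -sx mulgA mulgK.
Qed.

(** * The abstract group presented by the relations of V3t *)

Definition V3t_pres : Type := presented V3t_relators.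
HB.instance Definition _ := Group.on V3t_pres.

Definition wgen (x : option V3_gen) : V3t_pres := pgen V3t_relators x.

Lemma V3_relatorsP (G : groupType) (x : V3_gen -> G) :
  V3_relators `<=` kersg (feval x) <->
  commute (x A13) (x B13) /\ commute (x A23) (x B23).
Proof.
have E u v : feval x [~ u, v] = 1 <-> commute (feval x u) (feval x v).
  by rewrite gmulfR; split=> [/eqP/commgP|/commgP/eqP].
split=> [Rx|[c1 c2] r].
  by rewrite -!(feval_gen x); split; apply/E/Rx; [left|right].
by case=> ->; apply/E; rewrite !feval_gen.
Qed.

Lemma V3t_relatorsP (G : groupType) (x : option V3_gen -> G) :
  V3t_relators `<=` kersg (feval x) <->
  [/\ commute (x (Some A13)) (x (Some B13)), commute (x (Some A23)) (x (Some B23))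
    & commute (x (Some A13) * x (Some A23)) (x None)].
Proof.
have E u v : feval x [~ u, v] = 1 <-> commute (feval x u) (feval x v).
  by rewrite gmulfR; split=> [/eqP/commgP|/commgP/eqP].
split=> [Rx|[c1 c2 c3] r].
  rewrite -!(feval_gen x) -gmulfM.
  by split; apply/E/Rx; [left; left|left; right|right].
by case=> [[]|] ->; apply/E; rewrite ?gmulfM /= !feval_gen.
Qed.

Lemma wgen_commute :
  [/\ commute (wgen (Some A13)) (wgen (Some B13)),
      commute (wgen (Some A23)) (wgen (Some B23))
    & commute (wgen (Some A13) * wgen (Some A23)) (wgen None)].
Proof. by apply/V3t_relatorsP => r /sub_normal_closure/pres_rel_eq1. Qed.

Lemma commuteJ (G : groupType) (x y z : G) : commute x y -> commute (x ^ z) (y ^ z).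
Proof. by move=> xy; rewrite /commute -!conjMg xy. Qed.

(** These are the values of g |-> g ^ sigma1 on the generators, read off from the
    four identities above; unshift_gen does the same for sigma1^-1. *)
Definition shift_gen (x : option V3_gen) : V3t_pres :=
  match x with
  | Some A13 => wgen (Some A23) ^ (wgen (Some A13))^-1
  | Some B13 => wgen (Some B23) ^ (wgen (Some A13))^-1
  | Some A23 => wgen (Some A13)
  | Some B23 => wgen (Some B13)
  | None => wgen None
  end.

Definition unshift_gen (x : option V3_gen) : V3t_pres :=
  match x with
  | Some A13 => wgen (Some A23)
  | Some B13 => wgen (Some B23)
  | Some A23 => wgen (Some A13) ^ wgen (Some A23)
  | Some B23 => wgen (Some B13) ^ wgen (Some A23)
  | None => wgen None
  end.

Fact shift_rel : V3t_relators `<=` kersg (feval shift_gen).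
Proof.
have [c1 c2 c3] := wgen_commute; apply/V3t_relatorsP; split=> //=.
  exact: commuteJ.
by rewrite conjgE invgK -!mulgA mulVg mulg1.
Qed.

Fact unshift_rel : V3t_relators `<=` kersg (feval unshift_gen).
Proof.
have [c1 c2 c3] := wgen_commute; apply/V3t_relatorsP; split=> //=.
  exact: commuteJ.
by rewrite conjgE mulVKg.
Qed.

Definition shift : V3t_pres -> V3t_pres := plift shift_rel.
Definition unshift : V3t_pres -> V3t_pres := plift unshift_rel.
HB.instance Definition _ := UMagmaMorphism.on shift.
HB.instance Definition _ := UMagmaMorphism.on unshift.

Lemma shift_wgen x : shift (wgen x) = shift_gen x.
Proof. exact: plift_gen. Qed.

Lemma unshift_wgen x : unshift (wgen x) = unshift_gen x.
Proof. exact: plift_gen. Qed.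

Lemma shiftK : cancel shift unshift.
Proof.
apply: (@pres_ext _ _ _ (unshift \o shift) idfun) => x /=.
rewrite shift_wgen; case: x => [[]|] /=;
  by rewrite ?gmulfJ /= ?gmulfV /= !unshift_wgen /= ?conjgK.
Qed.

Lemma unshiftK : cancel unshift shift.
Proof.
apply: (@pres_ext _ _ _ (shift \o unshift) idfun) => x /=.
rewrite unshift_wgen; case: x => [[]|] /=;
  by rewrite ?gmulfJ /= !shift_wgen /= ?conjgKV.
Qed.

Fact V3t_elt_rel : V3t_relators `<=` kersg (feval V3t_elt).
Proof.
have [c1 c2 _ _] := b_relations; apply/V3t_relatorsP; split=> /=.
- by rewrite a13E b13E; apply/commuteJ/commute_sym/commuteX/commute_sym.
- rewrite /a23 /b23; apply/commute_sym/commuteX/commute_sym.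
  exact: c2.
- exact: commute_a13a23_b12.
Qed.

Definition V3t_map : V3t_pres -> SG3 := plift V3t_elt_rel.
HB.instance Definition _ := UMagmaMorphism.on V3t_map.

Lemma V3t_map_gen x : V3t_map (wgen x) = V3t_elt x.
Proof. exact: plift_gen. Qed.

(** The automorphism shift is conjugation by sigma1, because both sides of the
    identity are homomorphisms in w after division by sigma1. *)
Lemma sigma1_shift w : sigma1 * V3t_map (shift w) = V3t_map w * sigma1.
Proof.
suff -> : V3t_map (shift w) = V3t_map w ^ sigma1 by rewrite mulVKg.
pose c := hom (fun x y : SG3 => conjMg x y sigma1).
move: w; apply: (@pres_ext _ _ _ (V3t_map \o shift) (c \o V3t_map)) => x.
rewrite /= shift_wgen V3t_map_gen conjgE.
apply: (mulgI sigma1); rewrite mulVKg.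
case: x => [[]|] /=; rewrite ?gmulfJ /= ?gmulfV /= !V3t_map_gen /=.
- exact: sigma1_a23J.
- exact: sigma1_a13.
- exact: sigma1_b23J.
- exact: sigma1_b13.
- by case: b_relations.
Qed.

(** * The action of SG3 on the right cosets of V3t sigma1^Z *)

Inductive sheet := Sheet0 | Sheet1 | Sheet2.

(** The triple (n, w, i) stands for sigma1^n w r_i, with r_0 = 1, r_1 = sigma2 and
    r_2 = sigma2 sigma1. Having the power of sigma1 in front means that moving
    one more sigma1 across w costs a single application of shift. *)
Definition state : Type := int * V3t_pres * sheet.

(** Right multiplication by sigma1: r_0 sigma1 = sigma1, r_1 sigma1 = r_2 and
    r_2 sigma1 = a13 r_1. *)
Definition state_sigma1 (s : state) : state :=
  let: (n, w, i) := s in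
  match i with
  | Sheet0 => ((n + 1)%R, shift w, Sheet0)
  | Sheet1 => (n, w, Sheet2)
  | Sheet2 => (n, w * wgen (Some A13), Sheet1)
  end.

Definition state_sigma1V (s : state) : state :=
  let: (n, w, i) := s in
  match i with
  | Sheet0 => ((n - 1)%R, unshift w, Sheet0)
  | Sheet1 => (n, w / wgen (Some A13), Sheet2)
  | Sheet2 => (n, w, Sheet1)
  end.

(** Right multiplication by sigma2: r_0 sigma2 = r_1, r_1 sigma2 = a23 and
    r_2 sigma2 = sigma1 r_2, the braid relation. *)
Definition state_sigma2 (s : state) : state :=
  let: (n, w, i) := s in
  match i with
  | Sheet0 => (n, w, Sheet1)
  | Sheet1 => (n, w * wgen (Some A23), Sheet0)
  | Sheet2 => ((n + 1)%R, shift w, Sheet2)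
  end.

Definition state_sigma2V (s : state) : state :=
  let: (n, w, i) := s in
  match i with
  | Sheet0 => (n, w / wgen (Some A23), Sheet1)
  | Sheet1 => (n, w, Sheet0)
  | Sheet2 => ((n - 1)%R, unshift w, Sheet2)
  end.

Fact state_sigma1K : cancel state_sigma1 state_sigma1V.
Proof. by case=> [[n w] []]; rewrite /= ?shiftK ?mulgK ?GRing.addrK. Qed.
Fact state_sigma1VK : cancel state_sigma1V state_sigma1.
Proof. by case=> [[n w] []]; rewrite /= ?unshiftK ?mulgVK ?GRing.subrK. Qed.
Fact state_sigma2K : cancel state_sigma2 state_sigma2V.
Proof. by case=> [[n w] []]; rewrite /= ?shiftK ?mulgK ?GRing.addrK. Qed.
Fact state_sigma2VK : cancel state_sigma2V state_sigma2.
Proof. by case=> [[n w] []]; rewrite /= ?unshiftK ?mulgVK ?GRing.subrK. Qed.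

Definition psigma1 := Permutation state_sigma1K state_sigma1VK.
Definition psigma2 := Permutation state_sigma2K state_sigma2VK.

(** This is right multiplication by an element g such that r_i g = f(i) r_i. The
    elements b12 and b23 have this property: sigma2 b12 = b13 sigma2,
    sigma2 sigma1 b12 = b13 sigma2 sigma1, and sigma2 sigma1 b23 = b12 sigma2 sigma1. *)
Definition translate (f : sheet -> V3t_pres) (s : state) : state :=
  let: (n, w, i) := s in (n, w * f i, i).

Fact translateK f : cancel (translate f) (translate (fun i => (f i)^-1)).
Proof. by case=> [[n w] i]; rewrite /= mulgK. Qed.
Fact translateVK f : cancel (translate (fun i => (f i)^-1)) (translate f).
Proof. by case=> [[n w] i]; rewrite /= mulgVK. Qed.

Definition ptranslate f := Permutation (translateK f) (translateVK f).

Definition pb12 := ptranslate (fun i => wgen (if i is Sheet0 then None else Some B13)).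
Definition pb23 := ptranslate (fun i => wgen (if i is Sheet2 then None else Some B23)).

Definition act_gen (x : sg_gen) : permutation state :=
  match x with
  | Sigma1 => psigma1
  | Sigma2 => psigma2
  | Tau1 => psigma1^-1 * pb12
  | Tau2 => psigma2^-1 * pb23
  end.

(** With b_i in place of tau_i, each relation becomes one equality of triples on
    each sheet, and follows from the values of shift and the three commutations
    that hold in V3t_pres by definition. *)
Fact act_gen_relators : SG3_relators `<=` kersg (feval act_gen).
Proof.
have br : psigma1 * psigma2 * psigma1 = psigma2 * psigma1 * psigma2.
  apply: permutation_ext => -[[n w] []] /=; rewrite ?gmulfM /= ?shift_wgen //=.
  by rewrite /= conjgE invgK -!mulgA mulVg mulg1.
have [c1 c2 c3] := wgen_commute.
have [] // := (SG3_pair_relations pb12 pb23 br).2; last first.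
  by move=> *; apply/SG3_relatorsP.
split; apply: permutation_ext => -[[n w] []] /=;
  rewrite ?gmulfM /= ?shift_wgen //= -?mulgA ?invgK ?mulVg ?mulg1 ?c1 ?c2 //.
by rewrite [wgen (Some A13) * _]mulgA c3.
Qed.

Definition act : SG3 -> permutation state := plift act_gen_relators.
HB.instance Definition _ := UMagmaMorphism.on act.

Lemma act_pgen x : act (pgen SG3_relators x) = act_gen x.
Proof. exact: plift_gen. Qed.

Lemma act_sigma1 : act sigma1 = psigma1.
Proof. exact: act_pgen. Qed.

Lemma act_sigma2 : act sigma2 = psigma2.
Proof. exact: act_pgen. Qed.

Lemma act_b12 : act b12 = pb12.
Proof. by rewrite gmulfM /= !act_pgen /= mulVKg. Qed.

Lemma act_b23 : act b23 = pb23.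
Proof. by rewrite gmulfM /= !act_pgen /= mulVKg. Qed.

(** On the sheet r_0 = 1 an element of V3t acts by right translation, so it can be
    recovered from its action. *)
Lemma act_V3t_map n w v : act (V3t_map v) (n, w, Sheet0) = (n, w * v, Sheet0).
Proof.
elim/pres_ind: v n w => [|u v Hu Hv|x] n w.
- by rewrite !gmulf1 mulg1.
- rewrite !gmulfF /= Hu; apply: (canLR (pfunK _)).
  by rewrite Hv mulgA mulgVK.
- rewrite V3t_map_gen; case: x => [[]|] /=.
  + by rewrite a13E expg2 gmulfJ /= gmulfM gmulfV /= act_sigma1 act_sigma2.
  + by rewrite /a23 expg2 gmulfM /= !act_sigma2.
  + by rewrite b13E gmulfJ /= gmulfV /= act_b12 act_sigma2.
  + by rewrite act_b23.
  + by rewrite act_b12.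
Qed.

Lemma act_sigma1_zpow n : act (zpow sigma1 n) (0%R, 1, Sheet0) = (n, 1, Sheet0).
Proof.
elim/int_step_ind: n => [|n IH|n IH]; first by rewrite gmulf1.
  by rewrite zpowS gmulfM /= act_sigma1 IH /= gmulf1.
by rewrite zpow_pred gmulfF /= act_sigma1 IH /= gmulf1.
Qed.

Lemma V3t_map_inj : injective V3t_map.
Proof.
apply: gmulf_inj => w w1; have := act_V3t_map 0%R 1 w.
by rewrite w1 gmulf1 mul1g => -[].
Qed.

(** * The normal form of the elements of SG3 *)

Definition coset_rep (i : sheet) : SG3 :=
  match i with Sheet0 => 1 | Sheet1 => sigma2 | Sheet2 => sigma2 * sigma1 end.

Definition state_val (s : state) : SG3 :=
  let: (n, w, i) := s in zpow sigma1 n * V3t_map w * coset_rep i.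

(** The action was designed for this identity. The set of g for which it holds
    is a subgroup, so it is enough to treat sigma1, sigma2, b12 and b23. *)
Lemma state_val_act (s : state) g : state_val (act g s) = state_val s * g.
Proof.
have shiftP n w :
    zpow sigma1 (n + 1)%R * V3t_map (shift w) = zpow sigma1 n * V3t_map w * sigma1.
  by rewrite zpowS -mulgA sigma1_shift mulgA.
have div (x y : SG3) : (forall s, state_val (act x s) = state_val s * x) ->
    (forall s, state_val (act y s) = state_val s * y) ->
    forall s, state_val (act (x / y) s) = state_val s * (x / y).
  move=> ex ey t; rewrite gmulfF /=; apply: (mulIg y).
  by rewrite -ey pfunVK ex mulgA mulgVK.
have translateP (p q u r h : SG3) : u * r = r * h -> p * (q * u) * r = p * q * r * h.
  by move=> e; rewrite -!mulgA e.
have [c1 c2 _ c3] := b_relations.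
have e1 : forall s, state_val (act sigma1 s) = state_val s * sigma1.
  move=> [[n w] []]; rewrite act_sigma1 /= ?mulg1 ?mulgA ?shiftP //.
  by rewrite gmulfM /= V3t_map_gen /= a13E conjgE invgK expg2 !mulgA mulgVK.
have e2 : forall s, state_val (act sigma2 s) = state_val s * sigma2.
  move=> [[n w] []]; rewrite act_sigma2 /= ?mulg1 ?mulgA ?shiftP //.
    by rewrite gmulfM /= V3t_map_gen /= /a23 expg2 !mulgA.
  by have := sigma_braid; rewrite -!mulgA => ->.
have e3 : forall s, state_val (act b12 s) = state_val s * b12.
  have e : b13 * sigma2 = sigma2 * b12 by rewrite b13E conjgE invgK mulgA mulgVK.
  move=> [[n w] []]; rewrite act_b12 /= gmulfM /= V3t_map_gen /=; apply: translateP.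
  - by rewrite mulg1 mul1g.
  - exact: e.
  - by rewrite mulgA e -(mulgA sigma2) -c1 mulgA.
have e4 : forall s, state_val (act b23 s) = state_val s * b23.
  move=> [[n w] []]; rewrite act_b23 /= gmulfM /= V3t_map_gen /=; apply: translateP.
  - by rewrite mulg1 mul1g.
  - by rewrite c2.
  - by rewrite c3 mulgA.
move: s; elim/pres_ind: g => [|x y ex ey|x] s.
- by rewrite gmulf1 mulg1.
- exact: div.
- (* From x' and x' y deduce y: this recovers tau_i from sigma_i and b_i. *)
  have mulV (x' y : SG3) : (forall s, state_val (act x' s) = state_val s * x') ->
    (forall s, state_val (act (x' * y) s) = state_val s * (x' * y)) ->
    forall s, state_val (act y s) = state_val s * y.
    move=> ex exy t; rewrite -[t](pfunVK (act x')); set t' := pfun_inv _ _.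
    by rewrite -[act y _]/((act x' * act y) t') -gmulfM exy ex mulgA.
  case: x; [exact: e1|exact: e2|exact: mulV e1 e3 s|exact: mulV e2 e4 s].
Qed.

Lemma SG3_normal_form g : exists n w i, g = zpow sigma1 n * V3t_map w * coset_rep i.
Proof.
have := state_val_act (0%R, 1, Sheet0) g; rewrite /= !gmulf1 !mul1g.
by case: (act g _) => [[n w] i] <-; exists n, w, i.
Qed.

(** * Presentations of V3t and V3 *)

Lemma gensg_V3_elt : gensg (range V3_elt) = V3 :> set SG3.
Proof.
rewrite eqEsubset; split; apply: gensg_min => g.
  case=> x _ <-; apply: sub_gensg.
  by case: x; [left; left; left|left; left; right|left; right|right].
move=> gV; apply: sub_gensg; move: gV.
by case=> [[[]|]|] ->; [exists A13|exists A23|exists B13|exists B23].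
Qed.

Lemma V3_elt_in x : sg_set V3 (V3_elt x).
Proof. by rewrite -gensg_V3_elt; apply: sub_gensg; exists x. Qed.

Lemma gensg_V3t_elt : gensg (range V3t_elt) = V3t :> set SG3.
Proof.
rewrite eqEsubset; split; apply: gensg_min => g.
  case=> -[x|] _ <-; apply: sub_gensg; last by right.
  by left; apply: V3_elt_in.
case=> [|->]; last by apply: sub_gensg; exists None.
rewrite -gensg_V3_elt; apply: gensg_min => {}g [x _ <-].
by apply: sub_gensg; exists (Some x).
Qed.

(** A word that is trivial in SG3 is trivial in the abstract group, since the
    abstract group embeds. *)
Lemma V3t_presentation : has_presentation V3t V3t_elt V3t_relators.
Proof.
apply: presentationP; [exact: gensg_V3t_elt | exact: V3t_elt_rel | move=> u u1].
by apply: V3t_map_inj; rewrite gmulf1 [LHS]plift_feval.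
Qed.

Lemma V3tP g : sg_set V3t g <-> exists w, V3t_map w = g.
Proof.
split=> [/(presentation_gen V3t_presentation)[u <-]|[w <-]].
  by exists (feval wgen u); apply: plift_feval.
have [u ->] := pres_surj w; rewrite -gensg_V3t_elt gensg_range.
by exists u => //; rewrite [RHS]plift_feval.
Qed.

Lemma V3_presentation : has_presentation V3 V3_elt V3_relators.
Proof.
have [c1 c2 _] := (V3t_relatorsP V3t_elt).1 V3t_elt_rel.
apply: presentationP; [exact: gensg_V3_elt | exact/V3_relatorsP | move=> u u1].
(* The retraction that kills b12; the relator [a13 a23, b12] goes to 1. *)
pose z (x : option V3_gen) : presented V3_relators :=
  if x is Some y then pgen V3_relators y else 1.
have Rz : V3t_relators `<=` kersg (feval z).
  have [d1 d2] : commute (z (Some A13)) (z (Some B13)) /\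
                 commute (z (Some A23)) (z (Some B23)).
    by apply/V3_relatorsP => r /sub_normal_closure/pres_rel_eq1.
  by apply/V3t_relatorsP; split=> //; apply: commute1.
have := presentation_eq1 V3t_presentation Rz (u := fmap Some u).
by rewrite !feval_fmap; apply.
Qed.

(** * The HNN extension *)

(** The relations of V3 include the two commutators, and the relation
    b12^-1 c b12 = c is [c, b12] = 1; conversely all of these hold in SG3. *)
Lemma V3t_HNN_presentation : has_presentation V3t V3t_elt V3t_hnn_relators.
Proof.
have V3R u v : feval V3_elt u = feval V3_elt v ->
    feval (pgen V3t_hnn_relators) (fmap Some u) =
    feval (pgen V3t_hnn_relators) (fmap Some v).
  move=> uv; apply/relator_eq/pres_rel_eq1/sub_normal_closure; left.
  by exists (u / v); [exact/relator_eq | exact: gmulfF].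
have [c1 c2 c3] := (V3t_relatorsP V3t_elt).1 V3t_elt_rel.
apply: (presentation_transfer (z := pgen V3t_hnn_relators)) V3t_presentation _ _ _ _.
- exact: gensg_V3t_elt.
- move=> r [[u u1 <-]|->]; first by rewrite /= feval_fmap.
  by apply/relator_eq; rewrite !gmulfM /= gmulfV /= !feval_gen /= -mulgA c3 mulKg.
- apply/V3t_relatorsP.
  have V3C x y : commute (V3_elt x) (V3_elt y) ->
      commute (pgen V3t_hnn_relators (Some x)) (pgen V3t_hnn_relators (Some y)).
    move=> xy; have := V3R (fgen x * fgen y) (fgen y * fgen x).
    by rewrite !feval_fmap !gmulfM /= !feval_gen; apply.
  split; [exact: V3C | exact: V3C |].
  set t := pgen _ None; set c := _ * _.
  have : t^-1 * c * t = c.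
    have /pres_rel_eq1/relator_eq :=
      sub_normal_closure (or_intror erefl : V3t_hnn_relators _).
    by rewrite !gmulfM /= gmulfV /= !feval_gen.
  by rewrite -mulgA => e; rewrite /commute -{2}e mulVKg.
- by move=> j; exists (fgen j); rewrite feval_gen.
Qed.

(** Each element of V3 is a word in the four generators, so the generators
    indexed by the whole of V3 can be eliminated. *)
Lemma V3t_HNN_extension :
  @is_HNN_extension SG3 V3t V3
    (gensg [set a13 * a23]) (gensg [set a13 * a23]) idfun b12.
Proof.
have cV3 : gensg [set a13 * a23] `<=` V3.
  apply: gensg_min => _ ->; exact: subgroupM (V3_elt_in A13) (V3_elt_in A23).
split=> //; first by exists id.
set S := (X in has_presentation _ _ X).
pose y x : V3 := Sub (V3_elt x) (mem_set (V3_elt_in x)).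
have yE u : val (feval y u) = feval V3_elt u by rewrite -(feval_comp y val).
have S1 : fmap Some @` kersg (feval (@id V3)) `<=` S by move=> r; left.
(* The generator of V3 is sent to the letter that it is as an element of V3. *)
pose z (x : option V3_gen) : presented S := pgen S (omap y x).
have [c1 c2 c3] := (V3t_relatorsP V3t_elt).1 V3t_elt_rel.
apply: (presentation_transfer (z := z)) V3t_presentation _ _ _ _.
- congr (sg_set (gensg _)); rewrite eqEsubset; split=> g.
    by case=> -[k|] _ <-; [left; have := valP k; rewrite inE | right].
  case=> [gV|->]; last by exists None.
  by exists (Some (Sub g (mem_set gV))).
- move=> r [[u u1 <-]|[a [k [l [ka la ->]]]]] /=.
    by rewrite feval_fmap (feval_comp id val) u1 gmulf1.
  rewrite gmulfF gmulfJ /= !feval_gen /= ka la.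
  have [n _ <-] : range (zpow (a13 * a23)) (val a).
    by rewrite -gensg1E; have := valP a; rewrite inE.
  have /commute_sym e := commute_zpow n (commute_sym c3).
  by rewrite conjgE e mulKg mulgV.
- apply/V3t_relatorsP.
  have zM x x' : commute (V3_elt x) (V3_elt x') -> commute (z (Some x)) (z (Some x')).
    move=> xx; rewrite /commute -!(pgen_groupM S1); congr (pgen S (Some _)).
    by apply: val_inj.
  split; [exact: zM | exact: zM |].
  rewrite -(pgen_groupM S1) /=; set c := _ * _.
  have cc : sg_set (gensg [set a13 * a23]) (val c) by apply: sub_gensg.
  have : feval (pgen S) (fgen (Some c) ^ fgen None / fgen (Some c)) = 1.
    apply/pres_rel_eq1/sub_normal_closure; right.
    by exists (Sub (val c) (mem_set cc)), c, c.
  rewrite gmulfF gmulfJ /= !feval_gen => /divg1_eq e.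
  by rewrite /commute -{2}e mulVKg.
- case=> [k|]; last by exists (fgen None); rewrite feval_gen.
  have [|u uk] := presentation_gen V3_presentation (g := val k).
    by have := valP k; rewrite inE.
  exists (fmap Some u); rewrite feval_fmap //.
  have -> : k = feval id (fmap y u) by apply/val_inj; rewrite feval_fmap yE uk.
  by rewrite -(pgen_group_rel S1) feval_fmap.
Qed.

(** * V3 as a free product *)

Lemma zpow_pair (m n : Zgroup) :
  zpow ((1%R, 0%R) : (Zgroup * Zgroup)%type) m *
  zpow ((0%R, 1%R) : (Zgroup * Zgroup)%type) n = (m, n).
Proof.
have zpow1 (k : Zgroup) : zpow (1%R : Zgroup) k = k.
  elim/int_step_ind: k => [|k IH|k IH] //; first by rewrite zpowS IH.
  by rewrite zpow_pred IH.
have zpow0 (k : Zgroup) : zpow (1 : Zgroup) k = 1.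
  by elim/int_step_ind: k => [|k IH|k IH] //; rewrite ?zpowS ?zpow_pred IH.
rewrite [LHS]surjective_pairing /=; congr pair.
  by rewrite !(zpow_mono fst) zpow1 zpow0 mulg1.
by rewrite !(zpow_mono snd) zpow1 zpow0 mul1g.
Qed.

(** Each of the two relators involves one pair of generators, which presents Z^2;
    the first factor is generated by a13 and b13, the second by a23 and b23. *)
Lemma V3_free_product :
  isog V3 (free_product (Zgroup * Zgroup)%type (Zgroup * Zgroup)%type).
Proof.
apply: isog_trans (isog_sym (isog_presented V3_presentation)) _.
pose Z2 : groupType := (Zgroup * Zgroup)%type.
pose R := @free_product_relators Z2 Z2.
have Rl : fmap inl @` kersg (feval (@id Z2)) `<=` R by move=> r; left.
have Rr : fmap inr @` kersg (feval (@id Z2)) `<=` R by move=> r; right.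
pose il := hom (pgen_groupM Rl); pose ir := hom (pgen_groupM Rr).
pose x1 : Z2 := (1%R, 0%R); pose x2 : Z2 := (0%R, 1%R).
have x12 : commute x1 x2 by rewrite /commute -!/(mul_pair _ _).
pose al (x : V3_gen) : presented R :=
  match x with A13 => il x1 | B13 => il x2 | A23 => ir x1 | B23 => ir x2 end.
have alR : V3_relators `<=` kersg (feval al).
  by apply/V3_relatorsP; split; apply: gmulf_commute.
have [u1 u2] : commute (pgen V3_relators A13) (pgen V3_relators B13) /\
               commute (pgen V3_relators A23) (pgen V3_relators B23).
  by apply/V3_relatorsP => r /sub_normal_closure/pres_rel_eq1.
pose be (k : Z2 + Z2) : presented V3_relators :=
  match k with inl k => hom (zpow2M u1) k | inr k => hom (zpow2M u2) k end.
have beR : R `<=` kersg (feval be).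
  move=> _ [] [u u0 <-]; rewrite /= feval_fmap.
    by rewrite (feval_comp id (hom (zpow2M u1))) u0 gmulf1.
  by rewrite (feval_comp id (hom (zpow2M u2))) u0 gmulf1.
exists (plift alR); exists (plift beR).
  apply: (@pres_ext _ _ _ (plift beR \o plift alR) idfun) => x /=.
  rewrite plift_gen; case: x => /=.
  - by apply: (etrans (plift_gen beR (inl x1))); rewrite /= mulg1.
  - by apply: (etrans (plift_gen beR (inr x1))); rewrite /= mulg1.
  - by apply: (etrans (plift_gen beR (inl x2))); rewrite /= mul1g.
  - by apply: (etrans (plift_gen beR (inr x2))); rewrite /= mul1g.
apply: (@pres_ext _ _ _ (plift alR \o plift beR) idfun) => k /=.
rewrite plift_gen; case: k => -[m n] /=.
  rewrite gmulfM /= !(zpow_mono (plift alR)) /= !plift_gen /=.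
  by rewrite -!(zpow_mono il) -gmulfM zpow_pair.
rewrite gmulfM /= !(zpow_mono (plift alR)) /= !plift_gen /=.
by rewrite -!(zpow_mono ir) -gmulfM zpow_pair.
Qed.

(** * The semidirect product decomposition *)

(** The homomorphism pi_SG3, packaged so that its compatibility with inverses and
    conjugation can be used as well. *)
Definition piS3 : SG3 -> 'S_3 := plift pi_gen_relators.
HB.instance Definition _ := UMagmaMorphism.on piS3.

Lemma piS3_sigma1 : piS3 sigma1 = tperm (inord 0) (inord 1).
Proof. exact: plift_gen. Qed.

Lemma piS3_sigma2 : piS3 sigma2 = tperm (inord 1) (inord 2).
Proof. exact: plift_gen. Qed.

Lemma piS3_tau1 : piS3 tau1 = tperm (inord 0) (inord 1).
Proof. exact: plift_gen. Qed.

Lemma piS3_tau2 : piS3 tau2 = tperm (inord 1) (inord 2).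
Proof. exact: plift_gen. Qed.

Lemma V3t_sub_SP3 : V3t `<=` SP3.
Proof.
have piV x : V3t_elt x \in [set g | piS3 g = 1].
  rewrite inE; case: x => [[]|] /=.
  - by rewrite a13E expg2 gmulfJ /= gmulfM /= piS3_sigma1 tperm2 conj1g.
  - by rewrite /a23 expg2 gmulfM /= piS3_sigma2 tperm2.
  - by rewrite b13E gmulfJ /= gmulfM /= piS3_sigma1 piS3_tau1 tperm2 conj1g.
  - by rewrite gmulfM /= piS3_sigma2 piS3_tau2 tperm2.
  - by rewrite gmulfM /= piS3_sigma1 piS3_tau1 tperm2.
rewrite -gensg_V3t_elt; apply: gensg_min => _ [x _ <-].
by have := piV x; rewrite inE.
Qed.

Lemma V3t_conj_sigma1 n g : sg_set V3t g -> sg_set V3t (g ^ zpow sigma1 n).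
Proof.
have JE w : V3t_map w ^ sigma1 = V3t_map (shift w).
  by apply: (mulgI sigma1); rewrite mulVKg sigma1_shift.
move=> gV; elim/int_step_ind: n => [|n|n]; first by rewrite conjg1.
  by rewrite zpowS conjgM => /V3tP[w <-]; apply/V3tP; exists (shift w).
rewrite zpow_pred conjgM => /V3tP[w <-]; apply/V3tP; exists (unshift w).
by rewrite -{2}(unshiftK w) -JE conjgK.
Qed.

(** In S_3, an element sigma1^n w r maps to (0 1)^n times the image of r. The
    image of r takes the point 2 to 2, 1 or 0 for the three representatives, and
    (0 1) fixes 2, so purity forces r = 1, and then n is even. *)
Lemma SP3_normal_form g : sg_set SP3 g -> exists n w, g = zpow a12 n * V3t_map w.
Proof.
move=> piE; have pi1 : piS3 g = 1 := piE; have [n [w [i gE]]] := SG3_normal_form g.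
have piW : piS3 (V3t_map w) = 1 by apply: V3t_sub_SP3; apply/V3tP; exists w.
have pia (m : int) : piS3 (zpow a12 m) = 1.
  by rewrite zpow_mono /a12 expg2 gmulfM /= piS3_sigma1 tperm2 zpow1n.
have ord_neq j k : j < 3 -> k < 3 -> (@inord 2 j == inord k) = (j == k).
  by move=> j3 k3; rewrite -val_eqE /= !inordK.
have {gE} [m [e gE]] : exists (m : int) (e : bool),
    g = zpow a12 m * sigma1 ^+ e * V3t_map w * coset_rep i.
  have [m [nE|nE]] := int_parity n; exists m; [exists false|exists true];
    rewrite gE nE zpow_sqr.
    by rewrite expg0 mulg1.
  by rewrite zpowS expg1.
have : piS3 (sigma1 ^+ e) * piS3 (coset_rep i) = 1.
  by move: pi1; rewrite gE !gmulfM /= pia piW mul1g mulg1.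
have e2 : piS3 (sigma1 ^+ e) (inord 2) = inord 2.
  by case: (e); rewrite ?gmulf1 ?perm1 //= piS3_sigma1 tpermD ?ord_neq.
case: i gE => /= gE.
- rewrite gmulf1 mulg1; case: e {e2} gE => gE; last first.
    by exists m, w; rewrite gE expg0 !mulg1.
  rewrite /= piS3_sigma1 => /permP/(_ (inord 0)); rewrite tpermL perm1 => /eqP.
  by rewrite ord_neq.
- rewrite piS3_sigma2 => /permP/(_ (inord 2)); rewrite permM e2 tpermR perm1 => /eqP.
  by rewrite ord_neq.
- rewrite gmulfM /= piS3_sigma1 piS3_sigma2 => /permP/(_ (inord 2)).
  by rewrite !permM e2 tpermR tpermR perm1 => /eqP; rewrite ord_neq.
Qed.

Lemma act_a12_zpow n : act (zpow a12 n) (0%R, 1, Sheet0) = ((n + n)%R, 1, Sheet0).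
Proof. by rewrite zpow_sqr act_sigma1_zpow. Qed.

Lemma SP3_semidirect : internal_semidirect SP3 V3t (gensg [set a12]).
Proof.
have aSP : gensg [set a12] `<=` SP3.
  apply: gensg_min => _ -> /=; change (piS3 a12 = 1).
  by rewrite /a12 expg2 gmulfM /= piS3_sigma1 tperm2.
split=> //; first exact: V3t_sub_SP3.
- move=> x g xV /SP3_normal_form[n [w ->]].
  rewrite conjgM zpow_sqr; have xV' := V3t_conj_sigma1 (n + n)%R xV.
  have wV : sg_set V3t (V3t_map w) by apply/V3tP; exists w.
  by rewrite conjgE; apply: subgroupM; [apply: subgroupV | apply: subgroupM].
- rewrite eqEsubset; split=> [g [/V3tP[w <-]]|_ ->]; last first.
    by split; apply: subgroup1.
  (* A common element moves the triple (0, 1, 1) both to (2n, 1, 1) and to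
     (0, w, 1). *)
  rewrite gensg1E => -[n _ nE]; have := act_a12_zpow n; rewrite nE act_V3t_map mul1g.
  by case=> _ ->; exact: gmulf1.
- rewrite eqEsubset; split=> [g|_ [x xV [y ya <-]]]; last first.
    by apply: subgroupM; [exact: V3t_sub_SP3 | exact: aSP].
  move=> /SP3_normal_form[n [w ->]].
  exists (V3t_map w ^ zpow sigma1 (- (n + n))%R).
    by apply: V3t_conj_sigma1; apply/V3tP; exists w.
  exists (zpow a12 n); first by rewrite gensg1E; exists n.
  have e : zpow sigma1 (- (n + n))%R * zpow sigma1 (n + n)%R = 1.
    rewrite -(zpowM sigma1 (- (n + n))%R (n + n)%R).
    by change (zpow sigma1 (- (n + n) + (n + n))%R = 1); rewrite GRing.addNr.
  by rewrite zpow_sqr conjgE (mulg1_eq e) -!mulgA e mulg1.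
Qed.

Lemma isog_a12 : isog (gensg [set a12]) Zgroup.
Proof.
apply: isog_sym.
have aP n : zpow a12 n \in sg_set (gensg [set a12]).
  by rewrite inE gensg1E; exists n.
pose f (n : Zgroup) : gensg [set a12] := Sub (zpow a12 n) (aP n).
have fM : {morph f : m n / m * n} by move=> m n; apply/val_inj; exact: zpowM.
exists (hom fM); apply: inj_surj_bij => [|y].
  apply: gmulf_inj => n /(congr1 val) /= n1; have := act_a12_zpow n.
  rewrite n1 gmulf1 => -[/esym/eqP].
  by rewrite -GRing.mulr2n Num.Theory.mulrn_eq0 => /eqP.
have [n _ ny] : range (zpow a12) (val y).
  by rewrite -gensg1E; have := valP y; rewrite inE.
by exists n; apply/val_inj.
Qed.

Theorem theorem4p2 :
  (internal_semidirect SP3 V3t (gensg [set a12]) /\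
   isog (gensg [set a12]) Zgroup) /\
  [/\ has_presentation V3t V3t_elt V3t_relators,
      @is_HNN_extension SG3 V3t V3
        (gensg [set a13 * a23]) (gensg [set a13 * a23]) idfun b12
    & has_presentation V3t V3t_elt V3t_hnn_relators] /\
  (has_presentation V3 V3_elt V3_relators /\
   isog V3 (free_product (Zgroup * Zgroup)%type (Zgroup * Zgroup)%type)).
Proof.
split; first by split; [exact: SP3_semidirect | exact: isog_a12].
split; last by split; [exact: V3_presentation | exact: V3_free_product].
split; first exact: V3t_presentation.
  exact: V3t_HNN_extension.
exact: V3t_HNN_presentation.
Qed.
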